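(* For every integer $n\geq 4$, $r(K_{3}, F_{4,n})=8n+1$ and $r_{\ast}(K_{3}, F_{4,n})=4n+4$.
   Context: For graphs $G,H$, the Ramsey number $r(G,H)$ is the least integer $r$ such that every red/blue edge-coloring of the complete graph $K_r$ contains a red copy of $G$ or a blue copy of $H$. For $r=r(G,H)$, let $K_{r-1}\sqcup S_{k}$ denote the graph obtained from $K_{r-1}$ by adding a new vertex $v$ and joining $v$ by edges to exactly $k$ vertices of $K_{r-1}$; the star-critical Ramsey number $r_{\ast}(G,H)$ is the least integer $k$ such that every red/blue edge-coloring of $K_{r-1}\sqcup S_{k}$ contains a red copy of $G$ or a blue copy of $H$. The generalized fan $F_{t,n}$ is $K_1+nK_t$, the join of a single vertex with the disjoint union of $n$ copies of the complete graph $K_t$. *)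

(* Defs.v *)
From mathcomp Require Import all_boot.

Set Implicit Arguments.
Unset Strict Implicit.
Unset Printing Implicit Defensive.

Record sgraph := SGraph {
  vertex :> finType;
  adj : rel vertex;
  adj_sym : symmetric adj;
  adj_irrefl : irreflexive adj
}.

Section Complete.
Variable m : nat.

Definition complete_adj : rel 'I_m := fun i j => i != j.

Lemma complete_sym : symmetric complete_adj.
Proof. by move=> i j; rewrite /complete_adj eq_sym. Qed.

Lemma complete_irrefl : irreflexive complete_adj.
Proof. by move=> i; rewrite /complete_adj eqxx. Qed.

Definition complete : sgraph := SGraph complete_sym complete_irrefl.
End Complete.

Section Join.
Variables G H : sgraph.

Definition join_adj : rel (G + H)%type := fun x y =>
  match x, y with
  | inl a, inl b => adj a b
  | inr a, inr b => adj a b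
  | _, _ => true
  end.

Lemma join_sym : symmetric join_adj.
Proof. by move=> [x|x] [y|y] //=; apply: adj_sym. Qed.

Lemma join_irrefl : irreflexive join_adj.
Proof. by move=> [x|x] /=; apply: adj_irrefl. Qed.

Definition join : sgraph := SGraph join_sym join_irrefl.
End Join.

(* copies n G is the disjoint union nG; the vertex (i, x) is x in copy i. *)
Section Copies.
Variables (n : nat) (G : sgraph).

Definition copies_adj : rel ('I_n * G)%type := fun x y =>
  (x.1 == y.1) && adj x.2 y.2.

Lemma copies_sym : symmetric copies_adj.
Proof. by move=> x y; rewrite /copies_adj eq_sym adj_sym. Qed.

Lemma copies_irrefl : irreflexive copies_adj.
Proof. by move=> x; rewrite /copies_adj adj_irrefl andbF. Qed.

Definition copies : sgraph := SGraph copies_sym copies_irrefl.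
End Copies.

Definition fan (t n : nat) : sgraph :=
  join (complete 1) (copies n (complete t)).

(* complete_star N k is K_N with a new vertex None joined to the k vertices
   0, ..., k-1 of K_N; it is meant for k <= N (for k > N it is K_(N+1)). Up to
   isomorphism the choice of the k neighbours is immaterial. *)
Section CompleteStar.
Variables N k : nat.

Definition complete_star_adj : rel (option 'I_N) := fun x y =>
  match x, y with
  | Some i, Some j => i != j
  | Some i, None | None, Some i => i < k
  | None, None => false
  end.

Lemma complete_star_sym : symmetric complete_star_adj.
Proof. by move=> [i|] [j|] //=; rewrite eq_sym. Qed.

Lemma complete_star_irrefl : irreflexive complete_star_adj.
Proof. by move=> [i|] //=; rewrite eqxx. Qed.

Definition complete_star : sgraph :=
  SGraph complete_star_sym complete_star_irrefl.
End CompleteStar.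

(* A red/blue edge-coloring of G is c : {set G} -> bool, the edge xy having
   color c [set x; y], with true for red and false for blue; the values of c
   on sets that are not edges of G are irrelevant. *)
Section ColorClass.
Variables (G : sgraph) (c : {set G} -> bool) (b : bool).

Definition color_adj : rel G := fun x y => adj x y && (c [set x; y] == b).

Lemma color_sym : symmetric color_adj.
Proof. by move=> x y; rewrite /color_adj adj_sym setUC. Qed.

Lemma color_irrefl : irreflexive color_adj.
Proof. by move=> x; rewrite /color_adj adj_irrefl. Qed.

Definition color_class : sgraph := SGraph color_sym color_irrefl.
End ColorClass.

(* Copies are subgraphs, not necessarily induced. *)
Definition contains_copy (F G : sgraph) : Prop :=
  exists f : G -> F, injective f /\ {homo f : x y / adj x y}.

Definition arrows (F G H : sgraph) : Prop :=
  forall c : {set F} -> bool,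
    contains_copy (color_class c true) G \/
    contains_copy (color_class c false) H.

Definition is_least (P : nat -> Prop) (m : nat) : Prop :=
  P m /\ forall k, P k -> m <= k.

Definition ramsey_number (G H : sgraph) (r : nat) : Prop :=
  is_least (fun m => arrows (complete m) G H) r.

Definition star_critical_ramsey_number (G H : sgraph) (s : nat) : Prop :=
  exists2 r, ramsey_number G H r &
    is_least (fun k => k <= r.-1 /\ arrows (complete_star r.-1 k) G H) s.

(* Main.v *)
Require Import Defs.
From mathcomp Require Import all_boot.
From mathcomp Require Import zify.

(** Colouring by a balanced cut gives both lower bounds: a blue fan lies on one
    side of the cut, and in the star version it would have to use the new
    vertex, which has at most three blue neighbours.

    For the upper bounds it is enough to treat [complete_star (8 * n)
    (4 * n + 4)], a subgraph of [complete (8 * n + 1)]. Suppose there is no red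
    triangle. A triangle-free graph on [4 * n + 3] vertices contains [n]
    disjoint stable 4-sets: such sets are removed greedily until eleven vertices
    are left, and there one looks at a vertex [x] of maximal degree [d]. If
    [d <= 4], the neighbourhood of [x] extends to a stable 4-set that leaves a
    stable triple among the non-neighbours of [x], and [x] completes this
    triple. If [d >= 5] and the non-neighbours, of which there are at most five,
    contain no stable triple, then two stable 4-sets are obtained from
    neighbours of [x] and at most two non-neighbours each.

    Hence a vertex with at most [4 * n - 4] red neighbours is the centre of a
    blue fan. If all red degrees are at least [4 * n - 3], then, since [n >= 4],
    the red graph on the [8 * n] vertices has no closed 5-walk and is bipartite
    with parts of size [4 * n], both of them blue cliques. The extra vertex then
    has four blue neighbours in one of the parts: otherwise it has red
    neighbours in both, and the large red degrees leave too few of them. *)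

Set Implicit Arguments.
Unset Strict Implicit.
Unset Printing Implicit Defensive.

(** * Subsets of prescribed size and packings *)

Section Subsets.
Variable T : finType.
Implicit Types A B X Y : {set T}.

Lemma disjointsU A B X :
  [disjoint A :|: B & X] = [disjoint A & X] && [disjoint B & X].
Proof. by rewrite !disjoints_subset subUset. Qed.

Lemma cards_disjointU A B : [disjoint A & B] -> #|A :|: B| = #|A| + #|B|.
Proof. by move=> AB; apply/eqP; rewrite (leq_card_setU A B).2. Qed.

Lemma exists_subset_card A k :
  k <= #|A| -> exists2 X : {set T}, X \subset A & #|X| = k.
Proof.
rewrite -bin_gt0 -cards_draws card_gt0 => /set0Pn[X].
by rewrite inE => /andP[XA /eqP kX]; exists X.
Qed.

Lemma exists_intermediate_card A B k :
    A \subset B -> #|A| <= k <= #|B| ->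
  exists2 X : {set T}, A \subset X & X \subset B /\ #|X| = k.
Proof.
move=> AB /andP[Ak kB].
have [|X] := @exists_subset_card (B :\: A) (k - #|A|).
  by rewrite cardsDS // leq_sub2r.
rewrite subsetD disjoint_sym => /andP[XB AX] cX.
exists (A :|: X); first exact: subsetUl.
by rewrite subUset AB XB cards_disjointU // cX subnKC.
Qed.

Lemma exists_disjoint_subsets_card A B k l :
    k <= #|A| -> l <= #|B| -> k + l <= #|A :|: B| ->
  exists X Y : {set T},
    [/\ X \subset A, Y \subset B, #|X| = k, #|Y| = l & [disjoint X & Y]].
Proof.
move=> kA lB klAB.
suff [X [XA cX lBX]] : exists X : {set T},
    [/\ X \subset A, #|X| = k & l <= #|B :\: X|].
  have [Y] := exists_subset_card lBX; rewrite subsetD disjoint_sym.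
  by case/andP=> YB XY cY; exists X, Y.
have [kAB|ABk] := leqP k #|A :\: B|.
  have [X] := exists_subset_card kAB; rewrite subsetD => /andP[XA XB cX].
  by exists X; rewrite (setDidPl _) // disjoint_sym.
have [|X ABX [XA cX]] := @exists_intermediate_card (A :\: B) A k (subsetDl A B).
  by rewrite ltnW.
exists X; split=> //.
suff : #|A :|: B| <= #|X| + #|B :\: X| by lia.
apply: leq_trans _ (leq_card_setU X (B :\: X)).1.
apply/subset_leq_card/subsetP => x.
rewrite !inE; have := subsetP ABX x; rewrite inE.
by case: (x \in X); case: (x \in A); case: (x \in B) => // /(_ isT).
Qed.

Lemma ltn5_card_setU (X Z U V : {set T}) :
    #|X| = 3 -> #|Z| = 3 -> #|U| <= 1 -> #|V| <= 1 ->
    3 < #|X :|: Z| -> 3 < #|X :|: U| -> 3 < #|Z :|: V| ->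
    [disjoint Z & U] -> [disjoint X & V] -> [disjoint U & V] ->
  5 < #|(X :|: Z) :|: (U :|: V)|.
Proof.
move=> cX cZ cU cV cXZ cXU cZV /disjoint_setI0 ZU /disjoint_setI0 XV UV.
have cUV := cards_disjointU UV.
have := cardsUI Z V; have := cardsUI X U => cXUI cZVI.
have [XU ZV] : X :&: U = set0 /\ Z :&: V = set0.
  by split; apply/eqP; rewrite -cards_eq0; lia.
have := cardsUI (X :|: Z) (U :|: V).
by rewrite setIUl !setIUr XU XV ZU ZV !setU0 cards0; lia.
Qed.

Lemma leq_card_bigcup (I : finType) (P : pred I) (F : I -> {set T}) :
  #|\bigcup_(i | P i) F i| <= \sum_(i | P i) #|F i|.
Proof.
elim/big_ind2: _ => [|k A l B Ak Bl|//]; first by rewrite cards0.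
exact: leq_trans (leq_card_setU A B).1 (leq_add Ak Bl).
Qed.

End Subsets.

Section Packing.
Variables (T : finType) (p : pred {set T}) (t : nat).
Implicit Types A B Q : {set T}.

Definition packing (n : nat) (A : {set T}) : Prop :=
  exists P : {set {set T}},
    [/\ #|P| = n, trivIset P, cover P \subset A
      & {in P, forall Q, #|Q| = t /\ p Q}].

Lemma packing0 A : packing 0 A.
Proof.
exists set0; rewrite cards0 /cover big_set0 sub0set; split=> //.
  by apply/trivIsetP => ? ?; rewrite inE.
by move=> ?; rewrite inE.
Qed.

Lemma packing_subset n A B : A \subset B -> packing n A -> packing n B.
Proof.
by move=> AB [P [? ? PA ?]]; exists P; split=> //; apply: subset_trans AB.
Qed.

Hypothesis t_gt0 : 0 < t.

Lemma packingS n A Q :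
  Q \subset A -> #|Q| = t -> p Q -> packing n (A :\: Q) -> packing n.+1 A.
Proof.
move=> QA cQ pQ [P [cP tP PAQ PQ]].
have QP : {in P, forall B, [disjoint Q & B]}.
  move=> B BP; have := subset_trans (bigcup_sup B BP) PAQ.
  by rewrite subsetD disjoint_sym => /andP[].
have [|tQP QnP] := trivIsetU1 QP tP.
  by apply/negP => /PQ[]; move: t_gt0 => /[swap] <-; rewrite cards0.
exists (Q |: P); split=> //; first by rewrite cardsU1 QnP cP.
  rewrite /cover bigcup_setU big_set1 subUset QA.
  exact: subset_trans PAQ (subsetDl A Q).
by move=> B /setU1P[->|/PQ].
Qed.

Lemma packing_pair A Q Q' :
    Q \subset A -> Q' \subset A -> [disjoint Q & Q'] ->
    #|Q| = t -> #|Q'| = t -> p Q -> p Q' ->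
  packing 2 A.
Proof.
move=> QA Q'A QQ' cQ cQ' pQ pQ'; apply: (packingS QA) => //.
apply: (packingS (Q := Q')) => //; last exact: packing0.
by rewrite subsetD Q'A disjoint_sym.
Qed.

Lemma hereditary_packing n A :
    (forall B B', B \subset B' -> p B' -> p B) -> p A -> t * n <= #|A| ->
  packing n A.
Proof.
move=> p_sub; elim: n A => [|n IHn] A pA; first by move=> _; apply: packing0.
rewrite mulnS => tnA; have [|Q QA cQ] := @exists_subset_card _ A t.
  exact: leq_trans (leq_addr _ _) tnA.
apply: (packingS QA cQ (p_sub _ _ QA pA)); apply: IHn.
  exact: p_sub (subsetDl A Q) pA.
by rewrite cardsDS // cQ leq_subRL // (leq_trans (leq_addr _ _) tnA).
Qed.

End Packing.

Lemma packing_impl (T : finType) (p q : pred {set T}) (t n : nat)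
    (A : {set T}) :
    (forall Q : {set T}, Q \subset A -> p Q -> q Q) ->
  packing p t n A -> packing q t n A.
Proof.
move=> pq [P [cP tP PA Pp]]; exists P; split=> // Q QP; have [-> pQ] := Pp Q QP.
by split=> //; apply: pq pQ; apply: subset_trans PA; apply: bigcup_sup QP.
Qed.

(** * Stable sets in triangle-free graphs *)

Section TriangleFree.
Variables (T : finType) (r : rel T).
Implicit Types (A B I Q U V W X : {set T}) (u v w x y z : T).

Definition triangle_free : Prop := forall x y z, r x y -> r y z -> ~~ r x z.

Definition nbr x : {set T} := [set y | r x y].

Definition nbrs A : {set T} := \bigcup_(x in A) nbr x.

Definition nonnbr x : {set T} := ~: (x |: nbr x).

Definition stable A : bool := [forall x in A, forall y in A, ~~ r x y].

Definition has_stable (k : nat) A : bool :=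
  [exists Q : {set T}, [&& Q \subset A, #|Q| == k & stable Q]].

Lemma stableP A : reflect {in A &, forall x y, ~~ r x y} (stable A).
Proof.
apply: (iffP forall_inP) => [sA x y Ax|sA x Ax].
  exact: (forall_inP (sA x Ax)).
by apply/forall_inP => y; apply: sA.
Qed.

Lemma nbrs0 : nbrs set0 = set0.
Proof. by rewrite /nbrs big_set0. Qed.

Lemma nbrs1 x : nbrs [set x] = nbr x.
Proof. by rewrite /nbrs big_set1. Qed.

Lemma nbrs2 x y : nbrs [set x; y] = nbr x :|: nbr y.
Proof. by rewrite /nbrs bigcup_setU !big_set1. Qed.

Lemma stable0 : stable set0.
Proof. by apply/stableP => x y; rewrite inE. Qed.

Lemma stable_subset A B : A \subset B -> stable B -> stable A.
Proof.
by move=> /subsetP AB /stableP sB; apply/stableP => x y /AB xB /AB; apply: sB.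
Qed.

Lemma has_stableP k A :
  reflect (exists Q, [/\ Q \subset A, #|Q| = k & stable Q]) (has_stable k A).
Proof.
apply: (iffP existsP) => [[Q /and3P[QA /eqP cQ sQ]]|[Q [QA cQ sQ]]].
  by exists Q.
by exists Q; rewrite QA cQ eqxx sQ.
Qed.

Lemma has_stable_subset k A B : A \subset B -> has_stable k A -> has_stable k B.
Proof.
move=> AB /has_stableP[Q [QA cQ sQ]]; apply/has_stableP; exists Q; split=> //.
exact: subset_trans AB.
Qed.

Lemma stable_has_stable k A : stable A -> k <= #|A| -> has_stable k A.
Proof.
move=> sA /exists_subset_card[Q QA cQ]; apply/has_stableP; exists Q; split=> //.
exact: stable_subset sA.
Qed.

Hypothesis r_sym : symmetric r.

Lemma stableU A B :
  stable A -> stable B -> [disjoint nbrs A & B] -> stable (A :|: B).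
Proof.
move=> /stableP sA /stableP sB AB.
have nAB x y : x \in A -> y \in B -> ~~ r x y.
  move=> Ax By; apply/negP => xy; have /negP[] := disjointFl AB By.
  by apply/bigcupP; exists x; rewrite ?inE.
apply/stableP => x y /setUP[Ax|Bx] /setUP[Ay|By].
- exact: sA.
- exact: nAB.
- by rewrite r_sym nAB.
- exact: sB.
Qed.

Hypothesis r_tf : triangle_free.

Lemma triangle_free_irr x : ~~ r x x.
Proof. by apply/negP => xx; have := r_tf xx xx; rewrite xx. Qed.

Lemma stable1 x : stable [set x].
Proof. by apply/stableP => y z /set1P-> /set1P->; apply: triangle_free_irr. Qed.

Lemma stable2 x y : ~~ r x y -> stable [set x; y].
Proof.
move=> xy; apply: stableU (stable1 x) (stable1 y) _.
by rewrite nbrs1 disjoint_sym disjoints1 inE.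
Qed.

Lemma stable_nbr x : stable (nbr x).
Proof.
by apply/stableP => y z; rewrite !inE r_sym => yx xz; apply: r_tf xz.
Qed.

Lemma disjoint_nbr x y : r x y -> [disjoint nbr x & nbr y].
Proof.
move=> xy; rewrite disjoints_subset; apply/subsetP => z; rewrite !inE => xz.
by rewrite r_sym; apply: contraTN xz => zy; apply: r_tf xy _; rewrite r_sym.
Qed.

Lemma leq_card_nbr_adj A x y : r x y -> #|A :&: nbr x| + #|A :&: nbr y| <= #|A|.
Proof.
move=> /disjoint_nbr xy; rewrite -cards_disjointU.
  by rewrite -setIUr subset_leq_card ?subsetIl.
exact: disjointW (subsetIr _ _) (subsetIr _ _) xy.
Qed.

Lemma disjoint_nbr_nonnbr x : [disjoint nbr x & nonnbr x].
Proof. by rewrite disjoints_subset setCK subsetUr. Qed.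

Lemma card_nbr_nonnbr A x :
  x \in A -> #|A| = (#|A :&: nbr x| + #|A :&: nonnbr x|).+1.
Proof.
move=> Ax; rewrite (cardsD1 x) Ax -(cardsID (nbr x) (A :\ x)).
have -> : (A :\ x) :&: nbr x = A :&: nbr x.
  apply/setP => y; rewrite !inE; case: eqP => //= ->.
  by rewrite (negbTE (triangle_free_irr x)) andbF.
have -> // : (A :\ x) :\: nbr x = A :&: nonnbr x.
by rewrite setDDl setDE.
Qed.

Lemma has_stableU1 k A x :
  x \in A -> has_stable k (A :&: nonnbr x) -> has_stable k.+1 A.
Proof.
move=> Ax /has_stableP[Q [+ cQ sQ]]; rewrite subsetI subsetC => /andP[QA].
rewrite subUset sub1set inE => /andP[xQ xnQ].
apply/has_stableP; exists (x |: Q); split.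
- by rewrite subUset sub1set Ax.
- by rewrite cardsU1 xQ cQ.
apply: stableU (stable1 x) sQ _.
by rewrite nbrs1 disjoints_subset.
Qed.

(* The bound [r(K_3, K_k) <= 'C(k + 1, 2)]. *)
Lemma leq_bin_has_stable k A : 'C(k.+1, 2) <= #|A| -> has_stable k A.
Proof.
elim: k A => [|k IHk] A.
  by move=> _; apply/has_stableP; exists set0; rewrite sub0set cards0 stable0.
rewrite binS bin1 => kA; have /card_gt0P[x Ax] : 0 < #|A| by lia.
have [kx|xk] := ltnP k #|A :&: nbr x|.
  apply: has_stable_subset (subsetIl A (nbr x)) _; apply: stable_has_stable kx.
  exact: stable_subset (subsetIr _ _) (stable_nbr x).
by apply: (has_stableU1 Ax); apply: IHk; have := card_nbr_nonnbr Ax; lia.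
Qed.

Section NoStable.
Variables (k : nat) (W : {set T}).
Hypothesis W_no_stable : ~~ has_stable k.+1 W.

Lemma leq_card_no_stable X : X \subset W -> stable X -> #|X| <= k.
Proof.
move=> XW sX; rewrite leqNgt; apply: contra W_no_stable => kX.
exact: has_stable_subset XW (stable_has_stable sX kX).
Qed.

Lemma no_stable_edge : k < #|W| -> exists x y, [/\ x \in W, y \in W & r x y].
Proof.
move=> kW; have /forall_inPn[x Wx /forall_inPn[y Wy]] : ~~ stable W.
  by apply/negP => /(leq_card_no_stable (subxx W)); rewrite leqNgt kW.
by rewrite negbK; exists x, y.
Qed.

Lemma no_stable_nbr x X :
    X \subset W -> stable X -> x \in W :\: X -> k <= #|X| ->
  exists2 y, y \in X & r x y.
Proof.
move=> XW sX; rewrite inE => /andP[xX Wx] kX; apply/exists_inP.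
apply: contraTT kX; rewrite negb_exists_in => /forall_inP x_nadj.
rewrite -ltnNge -[_.+1](_ : #|x |: X| = _); last by rewrite cardsU1 xX.
apply: leq_card_no_stable; first by rewrite subUset sub1set Wx.
apply: stableU (stable1 x) sX _.
rewrite nbrs1 disjoint_sym disjoints_subset; apply/subsetP => y Xy.
by rewrite !inE x_nadj.
Qed.

End NoStable.

(** * Two disjoint stable 4-sets among eleven vertices *)

Lemma stable_extend k A I U X :
    U \subset A :\: I -> I \subset A -> stable U -> stable I -> #|U| <= k ->
    X \subset I :\: nbrs U -> #|X| = k - #|U| ->
  [/\ U :|: X \subset A, #|U :|: X| = k & stable (U :|: X)].
Proof.
rewrite !subsetD => /andP[UA UI] IA sU sI Uk /andP[XI XU] cX; split.
- by rewrite subUset UA (subset_trans XI IA).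
- by rewrite cards_disjointU ?(disjointWr XI UI) // cX subnKC.
- by apply: stableU sU (stable_subset XI sI) _; rewrite disjoint_sym.
Qed.

(* Hall's condition for two sets: [U] and [V] are completed to disjoint stable
   [k]-sets by vertices of [I]. *)
Lemma packing_stable_extend k A I U V :
    0 < k -> I \subset A -> U \subset A :\: I -> V \subset A :\: I ->
    [disjoint U & V] -> stable I -> stable U -> stable V ->
    #|U| <= k -> #|V| <= k ->
    k <= #|U| + #|I :\: nbrs U| -> k <= #|V| + #|I :\: nbrs V| ->
    2 * k <= #|U| + #|V| + #|I :\: (nbrs U :&: nbrs V)| ->
  packing stable k 2 A.
Proof.
move=> k_gt0 IA UAI VAI UV sI sU sV Uk Vk kU kV; rewrite setDIr => kUV.
have [||| X [Y [XI YI cX cY XY]]] := @exists_disjoint_subsets_card _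
  (I :\: nbrs U) (I :\: nbrs V) (k - #|U|) (k - #|V|); rewrite ?leq_subLR //.
  by lia.
have [QA cQ sQ] := stable_extend UAI IA sU sI Uk XI cX.
have [RA cR sR] := stable_extend VAI IA sV sI Vk YI cY.
apply: (packing_pair k_gt0 QA RA) => //.
have disj (B C D : {set T}) :
    B \subset A :\: I -> C \subset I :\: D -> [disjoint B & C].
  by rewrite !subsetD => /andP[_ BI] /andP[CI _]; apply: disjointWr CI BI.
rewrite disjointsU ![[disjoint _ & V :|: Y]]disjoint_sym !disjointsU.
rewrite ![[disjoint _ & U]]disjoint_sym UV (disj _ _ _ UAI YI).
by rewrite (disj _ _ _ VAI XI) disjoint_sym.
Qed.

Section ExtendByStable.
Variables (k : nat) (A I : {set T}).
Hypotheses (k_gt1 : 1 < k) (I_stable : stable I) (IA : I \subset A).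

Lemma packing_extend_vertex x :
    x \in A :\: I -> 2 * k <= #|I|.+1 -> #|I :&: nbr x| + k <= #|I|.+1 ->
  packing stable k 2 A.
Proof.
move=> xA kI kx; have := cardsID (nbr x) I => cI.
apply: (packing_stable_extend (I := I) (U := [set x]) (V := set0)) => //;
  rewrite ?sub1set ?sub0set ?disjoints1 ?in_set0 ?stable0 ?stable1 //;
  rewrite ?cards0 ?cards1 ?nbrs0 ?nbrs1 ?setI0 ?setD0;
  by clear -k_gt1 kI kx cI; lia.
Qed.

Lemma packing_extend_edge x y :
    x \in A :\: I -> y \in A :\: I -> r x y -> 2 * k <= #|I|.+2 ->
    #|I :&: nbr x| + k <= #|I|.+1 -> #|I :&: nbr y| + k <= #|I|.+1 ->
  packing stable k 2 A.
Proof.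
move=> xA yA xy kI kx ky; have := cardsID (nbr x) I; have := cardsID (nbr y) I.
move=> cIy cIx.
apply: (packing_stable_extend (I := I) (U := [set x]) (V := [set y])) => //;
  rewrite ?sub1set ?disjoints1 ?stable1 ?cards1 ?nbrs1 //;
  try by clear -k_gt1 kI kx ky cIx cIy; lia.
  by rewrite inE; apply: contraTneq xy => ->; apply: triangle_free_irr.
by rewrite (disjoint_setI0 (disjoint_nbr xy)) setD0; clear -kI; lia.
Qed.

Lemma packing_extend_nonedge x y :
    x \in A :\: I -> y \in A :\: I -> x != y -> ~~ r x y -> 2 * k <= #|I|.+2 ->
    #|I :&: (nbr x :|: nbr y)| + k <= #|I|.+2 ->
  packing stable k 2 A.
Proof.
move=> xA yA nxy xy kI kxy; have := cardsID (nbr x :|: nbr y) I => cI.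
apply: (packing_stable_extend (I := I) (U := [set x; y]) (V := set0)) => //;
  rewrite ?subUset ?sub1set ?xA ?yA ?sub0set ?stable0 ?stable2 ?cards2 ?nxy //;
  rewrite ?cards0 ?nbrs0 ?nbrs2 ?setI0 ?setD0;
  try by clear -k_gt1 kI kxy cI; lia.
by rewrite disjoint_sym disjoints_subset sub0set.
Qed.

Lemma packing_extend_cherry x y z :
    x \in A :\: I -> y \in A :\: I -> z \in A :\: I ->
    y != z -> r x y -> r x z ->
    2 * k <= #|I| + 3 -> #|I :&: nbr x| + k <= #|I|.+1 ->
    #|I :&: (nbr y :|: nbr z)| + k <= #|I|.+2 ->
  packing stable k 2 A.
Proof.
move=> xA yA zA nyz xy xz kI kx kyz.
have := cardsID (nbr y :|: nbr z) I; have := cardsID (nbr x) I => cIx cIyz.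
have nbr0 : (nbr y :|: nbr z) :&: nbr x = set0.
  rewrite setIUl ![_ :&: nbr x]setIC (disjoint_setI0 (disjoint_nbr xy)).
  by rewrite (disjoint_setI0 (disjoint_nbr xz)) setU0.
have yz : ~~ r y z by apply: r_tf xz; rewrite r_sym.
apply: (packing_stable_extend (I := I) (U := [set y; z]) (V := [set x])) => //;
  rewrite ?subUset ?sub1set ?yA ?zA ?stable1 ?stable2 ?cards1 ?cards2 ?nyz //;
  rewrite ?nbrs1 ?nbrs2 ?nbr0 ?setD0;
  try by clear -k_gt1 kI kx kyz cIx cIyz; lia.
rewrite disjoint_sym disjoints1 !inE negb_or.
by apply/andP; split; [apply: contraTneq xy | apply: contraTneq xz] => <-;
  apply: triangle_free_irr.
Qed.

End ExtendByStable.

Lemma packing_nonnbr k A Q x :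
    Q \subset A -> #|Q| = k.+1 -> stable Q -> x \in A :\: Q ->
    has_stable k ((A :&: nonnbr x) :\: Q) ->
  packing stable k.+1 2 A.
Proof.
move=> QA cQ sQ xA; rewrite -setIDAC => /(has_stableU1 xA)/has_stableP.
case=> R []; rewrite subsetD disjoint_sym => /andP[RA QR] cR sR.
exact: (packing_pair _ QA RA).
Qed.

Lemma packing_nbr_nonnbr k A x :
    x \in A -> k < #|A :&: nbr x| -> has_stable k (A :&: nonnbr x) ->
  packing stable k.+1 2 A.
Proof.
move=> xA /exists_subset_card[Q]; rewrite subsetI => /andP[QA Qx] cQ kx.
have sQ : stable Q := stable_subset Qx (stable_nbr x).
apply: (packing_nonnbr QA cQ sQ (x := x)).
  rewrite inE xA andbT; apply: contra (triangle_free_irr x) => /(subsetP Qx).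
  by rewrite inE.
rewrite (setDidPl _) // disjoint_sym.
exact: disjointW Qx (subsetIr _ _) (disjoint_nbr_nonnbr x).
Qed.

Lemma leq_card_second_nbrs A x d :
    x \in A -> {in A :&: nbr x, forall y, #|A :&: nbr y| <= d} ->
  #|(A :&: nonnbr x) :&: nbrs (A :&: nbr x)| <= #|A :&: nbr x| * d.-1.
Proof.
set N := A :&: nbr x; set W := A :&: nonnbr x => Ax deg; rewrite -sum_nat_const.
have /subset_leq_card/leq_trans :
    W :&: nbrs N \subset \bigcup_(y in N) (W :&: nbr y).
  apply/subsetP => z /setIP[Wz /bigcupP[y Ny yz]].
  by apply/bigcupP; exists y; rewrite // inE Wz.
apply; apply: leq_trans (leq_card_bigcup _ _) _; apply: leq_sum => y Ny.
have xy : x \in A :&: nbr y by move: Ny; rewrite !inE r_sym Ax => /andP[].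
have := deg y Ny; rewrite (cardsD1 x) xy => /(leq_sub2r 1); rewrite addKn subn1.
apply: leq_trans; apply/subset_leq_card/subsetP => z; rewrite !inE.
by rewrite negb_or => /andP[/and3P[-> -> _] ->].
Qed.

(* The neighbours of [x] are completed to a stable 4-set by non-neighbours, six
   of which are left: a stable triple among them goes with [x]. *)
Lemma packing_max_degree4 A x :
    #|A| = 11 -> x \in A -> #|A :&: nbr x| <= 4 ->
    {in A :&: nbr x, forall y, #|A :&: nbr y| <= #|A :&: nbr x|} ->
  packing stable 4 2 A.
Proof.
set N := A :&: nbr x; set W := A :&: nonnbr x => cA Ax d4 deg.
have cW : #|W| = 10 - #|N|.
  by have := card_nbr_nonnbr Ax; rewrite cA -/N -/W; lia.
have cWN : #|W :&: nbrs N| <= #|N| * #|N|.-1 := leq_card_second_nbrs Ax deg.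
have /has_stableP[Q [QWN cQ sQ]] : has_stable (4 - #|N|) (W :\: nbrs N).
  apply: leq_bin_has_stable; have := cardsID (nbrs N) W; rewrite bin2.
  move: cW cWN d4; move: #|W| #|W :&: _| #|W :\: _|.
  by case: #|N| => [|[|[|[|[|?]]]]] //=; lia.
have QW : Q \subset W := subset_trans QWN (subsetDl _ _).
have NW : [disjoint N & W].
  exact: disjointW (subsetIr _ _) (subsetIr _ _) (disjoint_nbr_nonnbr x).
have NQ : [disjoint N & Q] := disjointWr QW NW.
have sNQ : stable (N :|: Q).
  apply: stableU (stable_subset (subsetIr _ _) (stable_nbr x)) sQ _.
  by move: QWN; rewrite subsetD disjoint_sym => /andP[].
apply: (packing_nonnbr (Q := N :|: Q) (x := x)) => //.
- by rewrite subUset subsetIl (subset_trans QW) ?subsetIl.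
- by rewrite cards_disjointU // cQ subnKC.
- rewrite !inE Ax (negbTE (triangle_free_irr x)) andbF /= andbT.
  by apply/negP => /(subsetP QW); rewrite !inE eqxx andbF.
have WN : W :\: N = W by apply/setDidPl; rewrite disjoint_sym.
apply: leq_bin_has_stable; rewrite bin2 -/W -setDDl WN cardsDS // cW cQ /=.
by clear -d4; lia.
Qed.

Section NoStableTriple.
Variables (A I W : {set T}).
Hypotheses (IA : I \subset A) (WAI : W \subset A :\: I).
Hypotheses (I_stable : stable I) (W_no_stable3 : ~~ has_stable 3 W).

Local Notation degI x := #|I :&: nbr x|.

Let mem_WDI x : x \in W -> x \in A :\: I := subsetP WAI x.

Lemma packing_stable7 : 7 <= #|I| -> 2 < #|W| -> packing stable 4 2 A.
Proof.
move=> cI /(no_stable_edge W_no_stable3)[x [y [Wx Wy xy]]].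
have cxy := leq_card_nbr_adj I xy; have [cx|cx] := leqP (degI x) 3.
  apply: (packing_extend_vertex _ I_stable IA (mem_WDI Wx)) => //.
  by clear -cI cx; lia.
apply: (packing_extend_vertex _ I_stable IA (mem_WDI Wy)) => //.
by clear -cI cx cxy; lia.
Qed.

(* Call a vertex of [W] small if it misses at least three vertices of [I]. Two
   adjacent vertices are never both large, nor may they both be small, so small
   and large vertices form two stable classes, of two vertices each. *)
Lemma packing_stable6 : 6 <= #|I| -> 3 < #|W| -> packing stable 4 2 A.
Proof.
move=> cI cW; pose small := [set x in W | degI x + 3 <= #|I|].
have [small_stable|] := boolP (stable small); last first.
  case/forall_inPn=> x + /forall_inPn[y + /negPn xy].
  rewrite !inE => /andP[Wx cx] /andP[Wy cy].
  apply: (packing_extend_edge _ I_stable IA (mem_WDI Wx) (mem_WDI Wy) xy);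
    by clear -cI cx cy; lia.
have small_W : small \subset W by apply/subsetP => x; rewrite inE => /andP[].
have large_stable : stable (W :\: small).
  apply/stableP => x y; rewrite !inE => /andP[+ Wx] /andP[+ Wy].
  rewrite Wx Wy /= => cx cy; apply/negP => /(leq_card_nbr_adj I) cxy.
  by clear -cI cx cy cxy; lia.
have c_small := leq_card_no_stable W_no_stable3 small_W small_stable.
have c_large := leq_card_no_stable W_no_stable3 (subsetDl W small) large_stable.
have c_W : #|small| + #|W :\: small| = #|W|.
  by rewrite -(cardsID small W) (setIidPr small_W).
have small_degI x : x \in small -> degI x <= 2.
  move=> Sx; have Wx := subsetP small_W x Sx.
  have [||y] :=
    no_stable_nbr W_no_stable3 (subsetDl W small) large_stable (x := x).
  - by rewrite 2!in_setD Sx Wx.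
  - by clear -cW c_small c_W; lia.
  rewrite !inE => /andP[+ Wy] /(leq_card_nbr_adj I) cxy.
  by rewrite Wy => cy; clear -cI cy cxy; lia.
have /cards2P[x [y [xy small_xy]]] : #|small| == 2.
  by rewrite eqn_leq c_small; clear -cW c_large c_W; lia.
have [Sx Sy] : x \in small /\ y \in small by rewrite small_xy set21 set22.
have [Wx Wy] := (subsetP small_W x Sx, subsetP small_W y Sy).
apply: (packing_extend_nonedge _ I_stable IA (mem_WDI Wx) (mem_WDI Wy) xy
  (stableP _ small_stable x y Sx Sy)) => //.
rewrite setIUr; apply: leq_trans (leq_add _ (leqnn 4)) (_ : 4 + 4 <= _) => //.
apply: leq_trans (leq_card_setU _ _).1 _.
exact: leq_add (small_degI x Sx) (small_degI y Sy).
Qed.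

Definition pentagon (s : seq T) : bool :=
  [&& size s == 5, all [in W] s & cycle r s].

Lemma pentagon_rot i s : pentagon s -> pentagon (rot i s).
Proof.
case/and3P=> s5 sW sC; rewrite /pentagon size_rot s5 rot_cycle sC andbT.
by rewrite (eq_all_r (mem_rot i s)).
Qed.

Lemma pentagon_rev s : pentagon s -> pentagon (rev s).
Proof.
case/and3P=> s5 sW sC; rewrite /pentagon size_rev s5 all_rev sW rev_cycle.
by rewrite (eq_cycle (e' := r)).
Qed.

Lemma card_nbr_no_stable3 x :
  x \in W -> #|W| = 5 -> #|W :&: nbr x| = 2 /\ #|W :&: nonnbr x| = 2.
Proof.
move=> Wx cW; have := card_nbr_nonnbr Wx; rewrite cW => -[cWx].
have c_nbr : #|W :&: nbr x| <= 2.
  apply: (leq_card_no_stable W_no_stable3 (subsetIl W (nbr x))).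
  exact: stable_subset (subsetIr _ _) (stable_nbr x).
have c_nonnbr : #|W :&: nonnbr x| <= 2.
  rewrite leqNgt; apply: contra W_no_stable3 => c3; apply: (has_stableU1 Wx).
  by apply: leq_bin_has_stable; rewrite bin2.
by clear -cWx c_nbr c_nonnbr; lia.
Qed.

Lemma no_stable3_nbr x y z :
    x \in W -> y \in W -> z \in W -> x != y -> ~~ r x y -> z != x -> z != y ->
  r z x || r z y.
Proof.
move=> Wx Wy Wz xy xy_nadj zx zy.
have [|||a] := @no_stable_nbr _ _ W_no_stable3 z [set x; y] _ (stable2 xy_nadj).
- by rewrite subUset !sub1set Wx.
- by rewrite !inE negb_or zx zy.
- by rewrite cards2 xy.
by rewrite !inE => /pred2P[]-> ->; rewrite ?orbT.
Qed.

Lemma pentagon_through x :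
  x \in W -> #|W| = 5 -> exists y z u v, pentagon [:: x; y; z; u; v].
Proof.
move=> Wx cW; have [] := card_nbr_no_stable3 Wx cW.
move=> /eqP/cards2P[y [v [yv nbr_x]]] /eqP/cards2P[z [u [zu nonnbr_x]]].
have [/setIP[Wy +] /setIP[Wv +]] : y \in W :&: nbr x /\ v \in W :&: nbr x.
  by rewrite nbr_x set21 set22.
have [/setIP[Wz +] /setIP[Wu +]] :
    z \in W :&: nonnbr x /\ u \in W :&: nonnbr x.
  by rewrite nonnbr_x set21 set22.
rewrite !inE !negb_or => /andP[zx xz] /andP[ux xu] xy xv.
have zu_adj : r z u.
  apply/negPn/negP => /(no_stable3_nbr Wz Wu Wx zu).
  by rewrite ![x == _]eq_sym zx ux (negbTE xz) (negbTE xu) => /(_ isT isT).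
have yv_nadj : ~~ r y v by apply: r_tf xv; rewrite r_sym.
have yv_adj a : a \in W -> ~~ r x a -> r a y || r a v.
  move=> Wa xa; apply: no_stable3_nbr yv_nadj _ _ => //;
    by apply: contraNneq xa => ->.
rewrite /pentagon /= Wx; case/orP: (yv_adj z Wz xz) => [zy|zv].
  have uy : ~~ r u y by apply: r_tf zy; rewrite r_sym.
  have := yv_adj u Wu xu; rewrite (negbTE uy) /= => uv.
  by exists y, z, u, v; rewrite Wy Wz Wu Wv xy r_sym zy zu_adj uv r_sym xv.
have uv : ~~ r u v by apply: r_tf zv; rewrite r_sym.
have := yv_adj u Wu xu; rewrite (negbTE uv) orbF => uy.
by exists y, u, z, v; rewrite Wy Wz Wu Wv xy r_sym uy r_sym zu_adj zv r_sym xv.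
Qed.

Section Pentagon.
Hypotheses (cI : #|I| = 5) (cW : #|W| = 5).

Lemma packing_pentagon x y z u v :
    pentagon [:: x; y; z; u; v] -> degI x <= 2 ->
    #|I :&: (nbr y :|: nbr v)| <= 3 ->
  packing stable 4 2 A.
Proof.
case/and3P=> _ /and5P[Wx Wy _ _ /andP[Wv _]] /and5P[xy yz zu uv /andP[vx _]].
move=> cx cyv; have yv : y != v.
  by apply: contraTneq uv => <-; rewrite r_sym; apply: r_tf yz zu.
have xv : r x v by rewrite r_sym.
apply: (packing_extend_cherry _ I_stable IA
  (mem_WDI Wx) (mem_WDI Wy) (mem_WDI Wv) yv xy xv); rewrite ?cI //.
  exact: leq_add cx _.
exact: leq_add cyv _.
Qed.

Lemma packing_pentagon_low x y z u v :
    pentagon [:: x; y; z; u; v] -> degI x <= 1 -> degI y <= 1 -> degI v <= 1 ->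
  packing stable 4 2 A.
Proof.
move=> xyzuv cx cy cv; apply: (packing_pentagon xyzuv); first exact: leqW.
rewrite setIUr; apply: leq_trans (leq_card_setU _ _).1 _.
exact: leqW (leq_add cy cv).
Qed.

Lemma packing_pentagon_high x y z u v :
    pentagon [:: x; y; z; u; v] -> degI x = 3 -> degI z = 3 ->
    degI y <= 1 -> degI u <= 1 -> degI v <= 1 ->
  packing stable 4 2 A.
Proof.
move=> xyzuv cx cz cy cu cv.
have [c_zx|c_xz] := leqP #|I :&: (nbr z :|: nbr x)| 3.
  by apply: (packing_pentagon (pentagon_rot 1 xyzuv)) c_zx; apply: leqW.
have [c_xu|c_xu] := leqP #|I :&: (nbr x :|: nbr u)| 3.
  by apply: (packing_pentagon (pentagon_rot 4 xyzuv)) c_xu; apply: leqW.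
have [c_vz|c_zv] := leqP #|I :&: (nbr v :|: nbr z)| 3.
  by apply: (packing_pentagon (pentagon_rot 3 xyzuv)) c_vz; apply: leqW.
have [_ _ /and5P[_ _ zu uv /andP[vx _]]] := and3P xyzuv.
have disj a b : r a b -> [disjoint I :&: nbr a & I :&: nbr b].
  by move/disjoint_nbr; apply: disjointW; apply: subsetIr.
rewrite setUC !setIUr in c_xz c_xu c_zv; rewrite setUC in c_zv.
rewrite r_sym in vx; have := ltn5_card_setU cx cz cu cv c_xz c_xu c_zv
  (disj _ _ zu) (disj _ _ vx) (disj _ _ uv).
by rewrite -!setIUr -cI ltnNge subset_leq_card ?subsetIl.
Qed.

Lemma packing_stable5 :
  {in W, forall x, degI x <= 1 \/ degI x = 3} -> packing stable 4 2 A.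
Proof.
move=> degI_W.
have [/exists_inP[x Wx /eqP cx]|] := boolP [exists x in W, degI x == 3].
  have [y [z [u [v xyzuv]]]] := pentagon_through Wx cW.
  have [_ /and5P[_ Wy Wz Wu /andP[Wv _]]] := and3P xyzuv.
  case/and5P=> xy _ zu _ /andP[vx _].
  have low_nbr a b : b \in W -> r a b -> degI a = 3 -> degI b <= 1.
    move=> Wb ab ca; have := leq_card_nbr_adj I ab.
    by case: (degI_W b Wb) => // ->; rewrite ca cI.
  have cy := low_nbr x y Wy xy cx; have cv : degI v <= 1.
    by apply: (low_nbr x) => //; rewrite r_sym.
  have [cz|cz] := degI_W z Wz; last first.
    exact: packing_pentagon_high xyzuv cx cz cy (low_nbr z u Wu zu cz) cv.
  have [cu|cu] := degI_W u Wu.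
    exact: packing_pentagon_low (pentagon_rot 2 xyzuv) cz cu cy.
  have xvuzy := pentagon_rot 4 (pentagon_rev xyzuv).
  exact: packing_pentagon_high xvuzy cx cu cv cz cy.
rewrite negb_exists_in => /forall_inP no_degI3.
have low x : x \in W -> degI x <= 1.
  by move=> Wx; have := no_degI3 x Wx; case: (degI_W x Wx) => // ->.
have [x Wx] : exists x, x \in W by apply/card_gt0P; rewrite cW.
have [y [z [u [v xyzuv]]]] := pentagon_through Wx cW.
have [_ /and5P[_ Wy _ _ /andP[Wv _]] _] := and3P xyzuv.
exact: packing_pentagon_low xyzuv (low x Wx) (low y Wy) (low v Wv).
Qed.

End Pentagon.

End NoStableTriple.

Lemma nonnbr_subset_setD A x : A :&: nonnbr x \subset A :\: (A :&: nbr x).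
Proof.
rewrite subsetD subsetIl disjoint_sym.
exact: disjointW (subsetIr _ _) (subsetIr _ _) (disjoint_nbr_nonnbr x).
Qed.

Lemma card_nbr_nonadj A x y :
    y \in A :&: nonnbr x ->
  #|A :&: nbr y| = #|A :&: nbr x :&: nbr y| + #|A :&: nonnbr x :&: nbr y|.
Proof.
rewrite !inE negb_or => /and3P[_ _ xy].
rewrite -(cardsID (nbr x) (A :&: nbr y)) setIAC; congr (_ + _).
apply: eq_card => z; rewrite !inE negb_or; case: eqVneq => [->|_].
  by rewrite r_sym (negbTE xy) !andbF.
by case: (z \in A); case: (r x z); case: (r y z).
Qed.

Lemma packing_degree4 A x :
  #|A| = 11 -> x \in A -> #|A :&: nbr x| = 4 -> packing stable 4 2 A.
Proof.
move=> cA Ax d4; apply: (packing_nbr_nonnbr Ax); first by rewrite d4.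
apply: leq_bin_has_stable; rewrite bin2.
by have := card_nbr_nonnbr Ax; rewrite cA d4 /=; lia.
Qed.

Lemma packing_card11 A : #|A| = 11 -> packing stable 4 2 A.
Proof.
move=> cA; have [x0 Ax0] : exists x, x \in A by apply/card_gt0P; rewrite cA.
have [x Ax maxx] := arg_maxnP (fun y => #|A :&: nbr y|) Ax0.
have [/exists_inP[y Ay /eqP]|] := boolP [exists y in A, #|A :&: nbr y| == 4].
  exact: packing_degree4.
rewrite negb_exists_in => /forall_inP no4.
have [d4|d5] := leqP #|A :&: nbr x| 4.
  by apply: (packing_max_degree4 cA Ax d4) => y /setIP[Ay _]; apply: maxx.
have [W3|W_no_stable3] := boolP (has_stable 3 (A :&: nonnbr x)).
  by apply: (packing_nbr_nonnbr Ax) W3; apply: ltnW.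
have IA : A :&: nbr x \subset A := subsetIl A _.
have WAI := nonnbr_subset_setD A x.
have sI := stable_subset (subsetIr A _) (stable_nbr x).
have cIW : #|A :&: nbr x| + #|A :&: nonnbr x| = 10.
  by have := card_nbr_nonnbr Ax; rewrite cA => -[].
have [d8|d7] := leqP 8 #|A :&: nbr x|.
  apply: packing_subset IA _; apply: hereditary_packing => //.
  exact: stable_subset.
have [d7'|d6] := leqP 7 #|A :&: nbr x|.
  by apply: (packing_stable7 IA WAI sI W_no_stable3 d7'); clear -d7 cIW; lia.
have [d6'|d5'] := leqP 6 #|A :&: nbr x|.
  by apply: (packing_stable6 IA WAI sI W_no_stable3 d6'); clear -d6 cIW; lia.
have cI : #|A :&: nbr x| = 5 by apply/eqP; rewrite eqn_leq -ltnS d5' d5.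
have cW : #|A :&: nonnbr x| = 5 by clear -cI cIW; lia.
apply: (packing_stable5 IA WAI sI W_no_stable3 cI cW) => w Ww.
have Aw : w \in A by case/setIP: Ww.
have [cWw _] := card_nbr_no_stable3 W_no_stable3 Ww cW.
have := no4 w Aw; have := maxx w Aw; rewrite /= (card_nbr_nonadj Ww) cWw cI.
by clear; lia.
Qed.

Lemma triangle_free_packing n A :
  2 <= n -> 4 * n + 3 <= #|A| -> packing stable 4 n A.
Proof.
elim: n A => // n IHn A; rewrite leq_eqVlt => /predU1P[<-|n2] cA.
  have [B BA cB] := exists_subset_card cA.
  exact: packing_subset BA (packing_card11 cB).
have /has_stableP[Q [QA cQ sQ]] : has_stable 4 A.
  by apply: leq_bin_has_stable; rewrite bin2; clear -n2 cA; lia.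
apply: (packingS _ QA) => //; apply: IHn n2 _; rewrite cardsDS // cQ.
by clear -cA; lia.
Qed.

(** * Triangle-free graphs of large minimum degree *)

Lemma card_nbr_sum A x : #|A :&: nbr x| = \sum_(y in A) r x y.
Proof.
rewrite -sum1_card (eq_bigl (fun y => (y \in A) && r x y)) => [|y].
  by rewrite big_mkcondr; apply: eq_bigr => y _; case: (r x y).
by rewrite !inE.
Qed.

(* No vertex has three neighbours on a closed 5-walk. *)
Lemma leq_card_nbr_5walk A x y z u v :
    cycle r [:: x; y; z; u; v] ->
  #|A :&: nbr x| + #|A :&: nbr y| + #|A :&: nbr z| + #|A :&: nbr u| +
    #|A :&: nbr v| <= 2 * #|A|.
Proof.
case/and5P=> xy yz zu uv /andP[vx _].
rewrite !card_nbr_sum -!big_split mulnC -sum_nat_const /=.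
apply: leq_sum => a _.
have nadj b c : r b c -> ~~ (r b a && r c a).
  by move=> bc; apply/andP => -[ba ca]; case/negP: (r_tf bc ca).
move: (nadj _ _ xy) (nadj _ _ yz) (nadj _ _ zu) (nadj _ _ uv) (nadj _ _ vx).
by do 5!case: (r _ a).
Qed.

Section LargeMinDegree.
Variables (A : {set T}) (d : nat).
Hypothesis deg_A : {in A, forall x, d <= #|A :&: nbr x|}.
Hypothesis d_large : 2 * #|A| < 5 * d.

Lemma no_closed_5walk x y z u v :
  all [in A] [:: x; y; z; u; v] -> ~~ cycle r [:: x; y; z; u; v].
Proof.
case/and5P=> Ax Ay Az Au /andP[Av _]; apply/negP => /(leq_card_nbr_5walk A).
have := leq_add (leq_add (leq_add (leq_add
  (deg_A Ax) (deg_A Ay)) (deg_A Az)) (deg_A Au)) (deg_A Av).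
by move/leq_trans => /[apply]; clear -d_large; lia.
Qed.

Lemma stable_common_nbr x :
  x \in A -> stable [set y in A | A :&: nbr x :&: nbr y != set0].
Proof.
move=> Ax; apply/stableP => y z; rewrite !inE.
case/andP=> Ay /set0Pn[u /setIP[/setIP[Au]]]; rewrite !inE => xu yu.
case/andP=> Az /set0Pn[v /setIP[/setIP[Av]]]; rewrite !inE => xv zv.
have := @no_closed_5walk x u y z v; rewrite /= Ax Au Ay Az Av => /(_ isT).
by rewrite xu (r_sym u) yu zv (r_sym v) xv !andbT.
Qed.

(* [A] has no room for three disjoint neighbourhoods, so for an edge [ab] every
   vertex has a common neighbour with [a] or with [b]. *)
Lemma large_min_degree_bipartite :
  exists2 X : {set T}, X \subset A & stable X && stable (A :\: X).
Proof.
have [->|/set0Pn[a Aa]] := eqVneq A set0.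
  by exists set0; rewrite ?sub0set // set0D stable0.
have [b] : exists b, b \in A :&: nbr a.
  apply/card_gt0P; apply: leq_trans (deg_A Aa).
  by clear -d_large; lia.
rewrite !inE => /andP[Ab ab].
exists [set y in A | A :&: nbr a :&: nbr y != set0].
  by apply/subsetP => y; rewrite inE => /andP[].
rewrite stable_common_nbr //=; apply: stable_subset (stable_common_nbr Ab).
apply/subsetP => y; rewrite !inE => /andP[+ Ay].
rewrite Ay negbK /= => /eqP ay0.
apply/negP => /eqP by0.
have := cardsUI (A :&: nbr a) (A :&: nbr b).
have := cardsUI (A :&: nbr a :|: A :&: nbr b) (A :&: nbr y).
rewrite (setIUl (A :&: nbr a)) -!setIIr !setIA ay0 by0 -setIA.
rewrite (disjoint_setI0 (disjoint_nbr ab)) setI0 setU0 cards0.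
have : #|A :&: nbr a :|: A :&: nbr b :|: A :&: nbr y| <= #|A|.
  by rewrite -!setIUr subset_leq_card ?subsetIl.
by move: (deg_A Aa) (deg_A Ab) (deg_A Ay); clear -d_large; lia.
Qed.

End LargeMinDegree.
End TriangleFree.

(** * Fans and triangles *)

Section Clique.
Variables (T : finType) (h : rel T).
Implicit Types (Q X : {set T}) (x : T).

Definition clique X : bool :=
  [forall x in X, forall y in X, (x != y) ==> h x y].

Lemma cliqueP X : reflect {in X &, forall x y, x != y -> h x y} (clique X).
Proof.
apply: (iffP forall_inP) => [cX x y Xx Xy|cX x Xx].
  exact/implyP/(forall_inP (cX x Xx)).
by apply/forall_inP => y Xy; apply/implyP/cX.
Qed.

Lemma clique_subset Q X : Q \subset X -> clique X -> clique Q.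
Proof.
by move=> /subsetP QX /cliqueP cX; apply/cliqueP => x y /QX Xx /QX; apply: cX.
Qed.

Lemma cliqueU1 x X :
  symmetric h -> X \subset nbr h x -> clique X -> clique (x |: X).
Proof.
move=> h_sym /subsetP xX /cliqueP cX; apply/cliqueP => y z.
case/setU1P=> [->|Xy] /setU1P[->|Xz]; rewrite ?eqxx //; last exact: cX.
  by move: (xX z Xz); rewrite inE.
by move: (xX y Xy); rewrite inE h_sym.
Qed.

End Clique.

Section Fan.
Variables (G : sgraph) (t n : nat).
Implicit Types (X : {set G}) (u v : G).
Local Notation e := (@adj G).

Lemma packing_fan v :
  packing (clique e) t n (nbr e v) -> contains_copy G (fan t n).
Proof.
case=> P [cP tP Pv P_clique].
pose B (i : 'I_n) := enum_val (cast_ord (esym cP) i).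
have BP i : B i \in P := enum_valP _.
have cB i : t = #|B i| by have [] := P_clique _ (BP i).
pose h i (j : 'I_t) := enum_val (cast_ord (cB i) j).
have hB i j : h i j \in B i := enum_valP _.
have h_inj i : injective (h i) by move=> j k /enum_val_inj/cast_ord_inj.
have h_eq i j i' j' : h i j = h i' j' -> i = i'.
  move=> hh; apply/(@cast_ord_inj _ _ (esym cP))/enum_val_inj.
  rewrite -[LHS](def_pblock tP (BP i) (hB i j)) hh.
  exact: def_pblock tP (BP i') (hB i' j').
have vh i j : adj v (h i j).
  have /(subsetP Pv) : h i j \in cover P by apply/bigcupP; exists (B i).
  by rewrite inE.
have vNh i j : v <> h i j.
  by move=> vE; have := vh i j; rewrite -vE adj_irrefl.
exists (fun x : fan t n => match x with inl _ => v | inr (i, j) => h i j end).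
split=> [[a|[i j]] [b|[i' j']]|[a|[i j]] [b|[i' j']]] //=.
- by rewrite (ord1 a) (ord1 b).
- by move/vNh.
- by move/esym/vNh.
- by move=> /[dup]/h_eq<- /h_inj->.
- by rewrite /complete_adj (ord1 a) (ord1 b).
- by rewrite adj_sym.
rewrite /copies_adj /= => /andP[/eqP<- jj'].
have [_ /cliqueP cl] := P_clique _ (BP i); apply: cl => //.
by rewrite (inj_eq (h_inj i)).
Qed.

Hypotheses (t_gt0 : 0 < t) (n_gt0 : 0 < n).

Lemma clique_star_fan X u :
    clique e X -> t * n <= #|X| -> u \notin X ->
    t <= #|X :&: nbr e u| ->
  contains_copy G (fan t n).
Proof.
move=> cX tnX uX /exists_subset_card[S]; rewrite subsetI => /andP[SX Su] cS.
have [v Sv] : exists v, v \in S by apply/card_gt0P; rewrite cS.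
have Xv := subsetP SX v Sv.
have uv : adj u v by move: (subsetP Su v Sv); rewrite inE.
have Xnbr x : x \in X -> x != v -> x \in nbr e v.
  by move=> Xx xv; rewrite inE (cliqueP _ _ cX) // eq_sym.
have uS : u \notin S by apply: contra uX => /(subsetP SX).
apply: (packing_fan (v := v)); rewrite -(prednK n_gt0).
apply: (packingS t_gt0 (Q := u |: S :\ v)).
- rewrite subUset sub1set inE adj_sym uv; apply/subsetP => x /setD1P[xv Sx].
  exact: Xnbr (subsetP SX x Sx) xv.
- by rewrite cardsU1 !inE (negbTE uS) andbF -cS [RHS](cardsD1 v) Sv.
- apply: cliqueU1 (@adj_sym G) (subset_trans (subsetDl S _) Su) _.
  exact: clique_subset (subset_trans (subsetDl S _) SX) cX.
apply: (packing_subset (A := X :\: S)).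
  apply/subsetP => x /setDP[Xx Sx]; rewrite in_setD Xnbr ?andbT //.
    rewrite !inE (negbTE Sx) andbF orbF; apply: contraNneq uX => <-; exact: Xx.
  by apply: contraNneq Sx => ->.
apply: hereditary_packing => //.
- by move=> Q Q' QQ'; apply: clique_subset QQ'.
- exact: clique_subset (subsetDl X S) cX.
rewrite cardsDS // cS leq_subRL -?mulnS ?prednK //.
by rewrite (leq_trans _ tnX) ?leq_pmulr.
Qed.

End Fan.

Lemma triangle_copy (G : sgraph) (x y z : G) :
  adj x y -> adj y z -> adj x z -> contains_copy G (complete 3).
Proof.
move=> xy yz xz; pose f (i : 'I_3) := nth x [:: x; y; z] i.
have f_homo : {homo f : i j / i != j >-> adj i j}.
  move=> [i i3] [j j3]; rewrite /f /=.
  case: i i3 => [|[|[|i]]] i3 //; case: j j3 => [|[|[|j]]] j3 //= _ //;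
    by rewrite adj_sym.
exists f; split=> // i j fij; apply/eqP/negPn/negP => /f_homo.
by rewrite fij adj_irrefl.
Qed.

Lemma triangle_copy_or_free (G : sgraph) :
  contains_copy G (complete 3) \/ triangle_free (@adj G).
Proof.
have [/existsP[x /existsP[y /existsP[z /and3P[xy yz xz]]]]|no_tri] :=
  boolP [exists x : G, exists y, exists z, [&& adj x y, adj y z & adj x z]].
  by left; apply: triangle_copy xy yz xz.
right=> x y z xy yz; apply: contra no_tri => xz.
by apply/existsP; exists x; apply/existsP; exists y; apply/existsP; exists z;
  rewrite xy yz.
Qed.

(** * Upper bounds *)

Section UpperBound.
Variables (F : sgraph) (c : {set F} -> bool) (n : nat) (K : {set F}) (w : F).
Hypotheses (n_ge4 : 4 <= n) (K_clique : clique (@adj F) K).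
Hypotheses (cK : #|K| = 8 * n) (wK : w \notin K).
Hypothesis w_deg : 4 * n + 4 <= #|K :&: nbr (@adj F) w|.
Implicit Types (X : {set F}) (x y : F).

Local Notation red := (color_adj c true).
Local Notation blue := (color_adj c false).
Local Notation blue_fan := (contains_copy (color_class c false) (fan 4 n)).

Hypothesis red_tf : triangle_free red.

Let red_sym : symmetric red := @color_sym F c true.

Let n_gt0 : 0 < n := leq_trans (isT : 0 < 4) n_ge4.

Lemma stable_red_clique_blue X : X \subset K -> stable red X -> clique blue X.
Proof.
move=> /subsetP XK /stableP sX; apply/cliqueP => x y Xx Xy xy.
have := sX x y Xx Xy; rewrite /color_adj (cliqueP _ _ K_clique) ?XK //=.
by case: (c _).
Qed.

Lemma large_stable_red_blue_fan X :
  X \subset K -> stable red X -> 4 * n < #|X| -> blue_fan.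
Proof.
move=> XK sX cX; have /cliqueP bX := stable_red_clique_blue XK sX.
have [x Xx] : exists x, x \in X by apply/card_gt0P; apply: leq_trans cX.
have cXx : 4 * n <= #|X :\ x| by rewrite (cardsD1 x) Xx in cX.
apply: (@clique_star_fan (color_class c false) 4 n isT n_gt0 (X :\ x) x) => //.
- exact: stable_red_clique_blue (subset_trans (subsetDl _ _) XK)
    (stable_subset (subsetDl _ _) sX).
- by rewrite !inE eqxx.
rewrite (setIidPl _); first by apply: leq_trans cXx; rewrite leq_pmulr.
by apply/subsetP => y /setD1P[yx Xy]; rewrite inE; apply: bX; rewrite // eq_sym.
Qed.

Lemma low_red_degree_blue_fan x :
  x \in K -> #|K :&: nbr red x| + 4 <= 4 * n -> blue_fan.
Proof.
move=> Kx dx; apply: (@packing_fan (color_class c false) 4 n x).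
have cW : 4 * n + 3 <= #|K :&: nonnbr red x|.
  have := card_nbr_nonnbr red_tf Kx; rewrite cK; clear -dx; lia.
have n_ge2 : 2 <= n := leq_trans (isT : 2 <= 4) n_ge4.
have := triangle_free_packing red_sym red_tf n_ge2 cW.
move/(packing_impl (q := clique blue)) => /(_ _)/packing_subset; apply.
  apply/subsetP => y; rewrite !inE negb_or => /and3P[Ky yx xy].
  have adj_xy : adj x y by apply: (cliqueP _ _ K_clique) => //; rewrite eq_sym.
  by move: xy; rewrite /= /color_adj adj_xy /=; case: (c _).
by move=> Q; rewrite subsetI => /andP[QK _]; apply: stable_red_clique_blue.
Qed.

Lemma blue_nbrs_blue_fan X :
    X \subset K -> stable red X -> 4 * n <= #|X| -> 4 <= #|X :&: nbr blue w| ->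
  blue_fan.
Proof.
move=> XK sX cX cXw.
apply: (@clique_star_fan (color_class c false) 4 n isT n_gt0 X w) => //.
  exact: stable_red_clique_blue.
by apply: contra wK; apply: subsetP.
Qed.

Lemma leq_card_nbr_colors X :
  #|X :&: nbr (@adj F) w| <= #|X :&: nbr red w| + #|X :&: nbr blue w|.
Proof.
apply: leq_trans (leq_card_setU _ _).1; apply/subset_leq_card/subsetP => x.
by rewrite !inE /color_adj => /andP[-> ->]; case: (c _).
Qed.

Lemma leq3_card_red_nbr X :
    {in K, forall x, 4 * n <= #|K :&: nbr red x| + 3} ->
    stable red X -> #|K :\: X| <= 4 * n -> 0 < #|K :&: X :&: nbr red w| ->
  #|(K :\: X) :&: nbr red w| <= 3.
Proof.
move=> deg /stableP sX cY /card_gt0P[x /setIP[/setIP[Kx Xx]]].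
rewrite inE => wx.
have Kx_Y : K :&: nbr red x \subset (K :\: X) :&: nbr red x.
  apply/subsetP => y; rewrite !inE => /andP[Ky xy]; rewrite Ky xy !andbT.
  by apply: contraL xy; apply: sX.
have := leq_card_nbr_adj red_sym red_tf (K :\: X) wx.
have := deg x Kx; move: (subset_leq_card Kx_Y) cY; clear; lia.
Qed.

Lemma triangle_free_red_blue_fan : blue_fan.
Proof.
have [/exists_inP[x Kx dx]|] :=
  boolP [exists x in K, #|K :&: nbr red x| + 4 <= 4 * n].
  exact: low_red_degree_blue_fan dx.
rewrite negb_exists_in => /forall_inP deg.
have deg_K : {in K, forall x, 4 * n <= #|K :&: nbr red x| + 3}.
  by move=> x /deg; clear; lia.
have [||X XK /andP[sX sY]] :=
  @large_min_degree_bipartite _ _ red_sym red_tf K (4 * n - 3).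
- by move=> x /deg_K; rewrite leq_subLR addnC.
- by rewrite cK; clear -n_ge4; lia.
have YK : K :\: X \subset K := subsetDl K X.
have cXY : #|X| + #|K :\: X| = 8 * n.
  by rewrite -cK -(cardsID X K) (setIidPr XK).
have [?|cX] := ltnP (4 * n) #|X|; first exact: large_stable_red_blue_fan sX _.
have [?|cY] := ltnP (4 * n) #|K :\: X|.
  exact: large_stable_red_blue_fan sY _.
have [?|bX] := leqP 4 #|X :&: nbr blue w|.
  by apply: blue_nbrs_blue_fan XK sX _ _ => //; clear -cXY cY; lia.
have [?|bY] := leqP 4 #|(K :\: X) :&: nbr blue w|.
  by apply: blue_nbrs_blue_fan YK sY _ _ => //; clear -cXY cX; lia.
exfalso; have rX := leq3_card_red_nbr deg_K sX cY; rewrite (setIidPr XK) in rX.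
have := leq3_card_red_nbr deg_K sY.
rewrite setDDr setDv set0U setIDA setIid (setIidPr XK) => /(_ cX) rY.
have := leq_card_nbr_colors X; have := leq_card_nbr_colors (K :\: X).
have := subset_leq_card (subsetIl X (nbr (@adj F) w)).
have := subset_leq_card (subsetIl (K :\: X) (nbr (@adj F) w)).
have := cardsID X (K :&: nbr (@adj F) w).
rewrite setIAC (setIidPr XK) -setIDAC.
by move: w_deg cX cY bX bY rX rY; clear -n_ge4; lia.
Qed.

End UpperBound.

Lemma clique_star_arrows (F : sgraph) (n : nat) (K : {set F}) (w : F) :
    4 <= n -> clique (@adj F) K -> #|K| = 8 * n -> w \notin K ->
    4 * n + 4 <= #|K :&: nbr (@adj F) w| ->
  arrows F (complete 3) (fan 4 n).
Proof.
move=> n_ge4 cK cardK wK w_deg c.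
have [|red_tf] := triangle_copy_or_free (color_class c true); first by left.
by right; apply: (triangle_free_red_blue_fan n_ge4 cK cardK wK w_deg red_tf).
Qed.

Lemma complete_star_arrows (n : nat) :
  4 <= n -> arrows (complete_star (8 * n) (4 * n + 4)) (complete 3) (fan 4 n).
Proof.
move=> n_ge4; have kN : 4 * n + 4 <= 8 * n by clear -n_ge4; lia.
pose F := complete_star (8 * n) (4 * n + 4); pose K : {set F} := [set~ None].
apply: (@clique_star_arrows F n K None) => //.
- by apply/cliqueP => -[i|] [j|]; rewrite !inE.
- by rewrite cardsC1 card_option card_ord.
- by rewrite !inE eqxx.
have some_inj : injective (fun i : 'I_(4 * n + 4) => Some (widen_ord kN i) : F).
  by move=> i j [/val_inj].
rewrite -[X in X <= _]card_ord -(card_codom some_inj).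
by apply/subset_leq_card/subsetP => _ /codomP[i ->]; rewrite !inE /= ltn_ord.
Qed.

Lemma arrows_copy (F F' G H : sgraph) :
  contains_copy F' F -> arrows F G H -> arrows F' G H.
Proof.
move=> [f [f_inj f_homo]] FGH c.
have lift b K : contains_copy (color_class (fun S => c (f @: S)) b) K ->
    contains_copy (color_class c b) K.
  move=> [g [g_inj g_homo]]; exists (f \o g); split; first exact: inj_comp.
  move=> x y /g_homo /andP[/f_homo fxy]; rewrite imsetU !imset_set1 => cxy.
  by rewrite /= /color_adj fxy.
by case: (FGH (fun S => c (f @: S))) => /lift; [left | right].
Qed.

Lemma complete_star_copy (N k : nat) :
  contains_copy (complete (N + 1)) (complete_star N k).
Proof.
exists (fun x : complete_star N k =>
  if x is Some i then lshift 1 i else rshift N ord0 : 'I_(N + 1)).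
split=> [[i|] [j|]|[i|] [j|]] //=; rewrite /complete_adj.
- by move/lshift_inj->.
- by move/eqP; rewrite eq_lrshift.
- by move/eqP; rewrite eq_rlshift.
- by rewrite eq_lrshift.
by rewrite eq_rlshift.
Qed.

(** * Lower bounds *)

Section CutColoring.
Variables (F : sgraph) (side : pred F).

Definition cut_coloring (S : {set F}) : bool :=
  [exists x in S, exists y in S, side x != side y].

Lemma cut_coloringE (x y : F) : cut_coloring [set x; y] = (side x != side y).
Proof.
apply/exists_inP/idP => [[u + /exists_inP[v]]|xy].
  by rewrite !inE => /pred2P[]-> /pred2P[]->; rewrite ?eqxx // eq_sym.
by exists x; rewrite ?set21 //; apply/exists_inP; exists y; rewrite ?set22.
Qed.

Lemma cut_coloring_triangle_free :
  ~ contains_copy (color_class cut_coloring true) (complete 3).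
Proof.
move=> [f [_ f_homo]].
have f2 (i j : 'I_3) : i != j -> side (f i) != side (f j).
  by move=> /f_homo /andP[_]; rewrite cut_coloringE eqb_id.
have := f2 ord0 (lift ord0 ord0) isT; have := f2 ord0 ord_max isT.
have := f2 (lift ord0 ord0) ord_max isT.
by do 3!case: (side _).
Qed.

Variables (t n : nat) (f : fan t n -> F).
Hypothesis f_homo :
  {homo f : x y / adj x y >-> color_adj cut_coloring false x y}.

Lemma cut_coloring_fan_side x : side (f x) = side (f (inl ord0)).
Proof.
case: x => [a|ij]; first by rewrite (ord1 a).
have /andP[_] : color_adj cut_coloring false (f (inr ij)) (f (inl ord0)).
  exact: f_homo.
by rewrite cut_coloringE eqbF_neg negbK => /eqP.
Qed.

End CutColoring.

Lemma card_fan (t n : nat) : #|fan t n| = (t * n).+1.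
Proof. by rewrite card_sum card_prod !card_ord mulnC. Qed.

Lemma fan_degree (t n : nat) (z : fan t n) :
  0 < n -> t <= #|nbr (@adj (fan t n)) z|.
Proof.
move=> n_gt0; have [i [o ->]] : exists (i : 'I_n) (o : option 'I_t),
    z = if o is Some j then inr (i, j) else inl ord0.
  case: z => [a|[i j]]; last by exists i, (Some j).
  by exists (Ordinal n_gt0), None; rewrite (ord1 a).
pose h (o : option 'I_t) : fan t n :=
  if o is Some j then inr (i, j) else inl ord0.
have h_inj : injective h by move=> [j|] [k|] //= [->].
have h_adj p : p != o -> adj (h o) (h p).
  case: o p => [j|] [k|] //= jk; rewrite /copies_adj /= eqxx /=.
  by rewrite /complete_adj eq_sym.
have ct : #|[set~ o]| = t by rewrite cardsC1 card_option card_ord.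
rewrite -[X in X <= _]ct -(card_imset _ h_inj).
apply/subset_leq_card/subsetP => _ /imsetP[p + ->].
by rewrite !inE => /h_adj.
Qed.

Lemma leq_card_ord_interval (N a b : nat) :
  #|[set i : 'I_N | a <= i < b]| <= b - a.
Proof.
rewrite cardE -(size_map val) -[X in _ <= X](size_iota a).
apply: uniq_leq_size; first by rewrite (map_inj_uniq val_inj) enum_uniq.
by move=> _ /mapP[i + ->]; rewrite mem_enum inE mem_iota /=; lia.
Qed.

Lemma leq_card_ord_side (N m : nat) (b : bool) :
  N <= 2 * m -> #|[set i : 'I_N | (i < m) == b]| <= m.
Proof.
move=> Nm; have [e1 e2] : m - 0 = m /\ 2 * m - m = m by lia.
case: b; [rewrite -[X in _ <= X]e1 | rewrite -[X in _ <= X]e2];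
  apply: leq_trans (leq_card_ord_interval N _ _); apply: subset_leq_card;
  apply/subsetP => i; rewrite !inE; have := ltn_ord i; lia.
Qed.

Lemma complete_not_arrows (t n N : nat) :
  N <= 2 * (t * n) -> ~ arrows (complete N) (complete 3) (fan t n).
Proof.
move=> N_le /(_ (@cut_coloring (complete N) (fun i => i < t * n))).
case=> [/cut_coloring_triangle_free//|[f [f_inj f_homo]]].
have := leq_card_ord_side (f (inl ord0) < t * n) N_le.
rewrite leqNgt -card_fan -(card_codom f_inj) => /negP; apply.
apply/subset_leq_card/subsetP => _ /codomP[x ->].
by rewrite inE (cut_coloring_fan_side f_homo).
Qed.

Lemma complete_star_not_arrows (t n N k : nat) :
    0 < n -> N <= 2 * (t * n) -> k < t * n + t ->
  ~ arrows (complete_star N k) (complete 3) (fan t n).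
Proof.
move=> n_gt0 N_le k_lt.
pose F := complete_star N k.
pose side (x : F) := if x is Some i then i < t * n else false.
case/(_ (cut_coloring side)) => [/cut_coloring_triangle_free//|].
case=> f [f_inj f_homo].
have Some_inj : injective (Some : 'I_N -> F) by move=> ? ? [].
have [/existsP[z /eqP fz]|no_None] := boolP [exists z, f z == None].
  have : #|f @: nbr (@adj (fan t n)) z| <= #|[set i : 'I_N | t * n <= i < k]|.
    rewrite -(card_imset _ Some_inj); apply/subset_leq_card/subsetP.
    move=> _ /imsetP[y + ->]; rewrite inE => /f_homo /andP[].
    rewrite fz cut_coloringE; case: (f y) => [i|] //= ik.
    rewrite eqbF_neg negbK => /eqP i_side.
    by apply: imset_f; rewrite inE ik leqNgt -i_side.
  rewrite card_imset // => /(leq_trans (fan_degree z n_gt0)).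
  by move/leq_trans/(_ (leq_card_ord_interval _ _ _)); clear -k_lt; lia.
have := leq_card_ord_side (side (f (inl ord0))) N_le.
rewrite leqNgt -card_fan -(card_codom f_inj) -(card_imset _ Some_inj).
move/negP; apply.
apply/subset_leq_card/subsetP => _ /codomP[x ->].
have := cut_coloring_fan_side f_homo x; case fx: (f x) => [i|] /= i_side.
  by apply: imset_f; rewrite inE i_side.
by case/existsP: no_None; exists x; rewrite fx.
Qed.

(** * The Ramsey numbers *)

Theorem theorem1p5 (n : nat) (hn : 4 <= n) :
  ramsey_number (complete 3) (fan 4 n) (8 * n + 1) /\
  star_critical_ramsey_number (complete 3) (fan 4 n) (4 * n + 4).
Proof.
have n_gt0 : 0 < n := leq_trans (isT : 0 < 4) hn.
have N_le : 8 * n <= 2 * (4 * n) by rewrite mulnA.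
have ramsey : ramsey_number (complete 3) (fan 4 n) (8 * n + 1).
  split=> [|m m_arrows].
    exact: arrows_copy (complete_star_copy _ _) (complete_star_arrows hn).
  rewrite addn1 ltnNge; apply/negP => /leq_trans/(_ N_le).
  by move/complete_not_arrows; apply.
split=> //; exists (8 * n + 1) => //; rewrite addn1 /=; split.
  by split; [lia | apply: complete_star_arrows].
move=> k [_ k_arrows]; rewrite leqNgt; apply/negP.
by move/(complete_star_not_arrows n_gt0 N_le); apply.
Qed.
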